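(* Let $q$ be an odd prime power, $n>1$, and let $\ell$ be a nonzero $q$-linear polynomial over $\mathbb F_{q^n}$ of degree less than $q^n$. Let $L=\frac{\ell+\ell'}2$ (with $'$ as defined in the context), and suppose $\dim_{\mathbb F_q}\operatorname{im}L=r$ for some integer $0<r\le n$. Let $\epsilon$ be the invariant of the quadratic form $\mathrm{Tr}(x\ell(x))$ and $\eta$ the quadratic character of $\mathbb F_q^*$. If $r=n$, then $\det M_L\in\mathbb F_q$ and $\epsilon=(-1)^{n-1}\eta(\det M_L)$. If $r<n$, then $\det M_L^{(r)}\neq0$, and: (1) $\big(\det M_L^{(r)}\big)^{q+1}=\big(\det M_L^{(r,1)}\big)^2$, where $M_L^{(r,1)}$ is the $r\times r$ submatrix of $M_L$ formed by rows $2,3,\dots,r+1$ and columns $1,\dots,r$; moreover $\epsilon=1$ if and only if $\big(\det M_L^{(r)}\big)^{\frac{q+1}2}=\det M_L^{(r,1)}$; (2) when $n$ is odd, $\epsilon=1$ if and only if $\det M_L^{(r)}$ is a square in $\mathbb F_{q^n}$; (3) when $r=n-2m$ and $\ell$ has degree $q^m$ with leading coefficient $a$, one has $a^{2q^r\frac{q^m-1}{q-1}}\det M_L^{(r)}\in\mathbb F_q$ and $\epsilon=(-1)^{n-1}\eta\Big(a^{2q^r\frac{q^m-1}{q-1}}\det M_L^{(r)}\Big)$.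
   Context: $\mathrm{Tr}$ denotes the trace map $\mathrm{Tr}(x)=\sum_{i=0}^{n-1}x^{q^i}$ of $\mathbb F_{q^n}/\mathbb F_q$. A $q$-linear polynomial is one of the form $\sum_i a_ix^{q^i}$; it is viewed as an $\mathbb F_q$-linear endomorphism of $\mathbb F_{q^n}$. For $L(x)=\sum_{i=0}^{n-1}a_ix^{q^i}$ with $a_i\in\mathbb F_{q^n}$, define $L'(x)=a_0x+\sum_{i=1}^{n-1}(a_ix)^{q^{n-i}}$, and let $M_L$ be the $n\times n$ matrix whose $(i,j)$ entry is $a_{(j-i)\bmod n}^{q^{i-1}}$ (first row $a_0,a_1,\dots,a_{n-1}$; second row $a_{n-1}^q,a_0^q,\dots,a_{n-2}^q$; etc.). For a matrix $M$ and positive integer $k$, $M^{(k)}$ denotes the submatrix formed by its first $k$ rows and first $k$ columns. The map $x\mapsto\mathrm{Tr}(x\ell(x))$ is a quadratic form on the $\mathbb F_q$-vector space $\mathbb F_{q^n}$; in suitable $\mathbb F_q$-coordinates $w_1,\dots,w_n$ it becomes $d_1w_1^2+\dots+d_rw_r^2$ with $d_1,\dots,d_r\in\mathbb F_q^*$; the integer $r$ (rank) and $\epsilon=\eta(d_1\cdots d_r)$ do not depend on the choice of coordinates, and $\epsilon$ is called the invariant of the quadratic form. *)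

(* Defs.v *)
From HB Require Import structures.
From mathcomp Require Import all_boot all_order all_algebra all_fingroup.
From mathcomp Require Import all_solvable all_field.
From mathcomp Require Import ring.

Set Implicit Arguments.
Unset Strict Implicit.
Unset Printing Implicit Defensive.

Import GRing.Theory.
Local Open Scope ring_scope.

(* F is the field with q = #|F| elements; E is an extension of F of degree n
   (the theorem assumes \dim {:E} = n), and c%:A is the image in E of c : F. *)

(* The character eta of F^*, extended by eta 0 = 0. *)
Definition quadchar (F : finFieldType) (c : F) : int :=
  if c == 0 then 0 else if [exists y : F, c == y ^+ 2] then 1 else -1.

Section LinearizedPolynomials.

Variables (F : finFieldType) (E : fieldExtType F) (n : nat).

Local Notation q := #|F|.

Definition qtrace (x : E) : E := \sum_(i < n) x ^+ (q ^ i).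

Definition qlinear (l : {poly E}) : Prop :=
  exists (m : nat) (a : nat -> E), l = \sum_(i < m) a i *: 'X^(q ^ i).

Definition qcoef (l : {poly E}) (i : nat) : E := l`_(q ^ i).

Definition qadj (l : {poly E}) : {poly E} :=
  qcoef l 0 *: 'X + \sum_(1 <= i < n) (qcoef l i *: 'X) ^+ (q ^ (n - i)).

Definition qsym (l : {poly E}) : {poly E} := 2%:R^-1 *: (l + qadj l).

(* linfun is only meaningful on linear maps; see qsym_linfun below. *)
Definition qimage (l : {poly E}) : {vspace E} := limg (linfun (horner l)).

(* Rows and columns are numbered from 0, whence the exponent q ^ i; the index
   (j + (n - i)) %% n is j - i modulo n. *)
Definition qmatrix (l : {poly E}) : 'M[E]_n :=
  \matrix_(i, j) qcoef l ((j + (n - i)) %% n) ^+ (q ^ i).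

(* Q : E -> E takes its values in the copy of F in E.  The coordinates are those
   relative to an F-basis b of E, and s is the rank of Q. *)
Definition quadform_invariant (Q : E -> E) (eps : int) : Prop :=
  exists (s : nat) (b : n.-tuple E) (d : 'I_n -> F),
    [/\ (s <= n)%N,
        basis_of {:E} b,
        forall i : 'I_n, (i < s)%N -> d i != 0,
        forall x : E,
          Q x = (\sum_(i < n | (i < s)%N) d i * coord b i x ^+ 2)%:A
      & eps = quadchar (\prod_(i < n | (i < s)%N) d i)].

Definition trace_form (l : {poly E}) (x : E) : E := qtrace (x * l.[x]).

End LinearizedPolynomials.

Section Submatrices.

Variables (R : Type) (n r : nat).

Definition leading_submx (hr : (r <= n)%N) (M : 'M[R]_n) : 'M[R]_r :=
  mxsub (widen_ord hr) (widen_ord hr) M.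

(* lift ord0 i : 'I_r.+1 has value i + 1. *)
Definition shifted_submx (hr : (r < n)%N) (M : 'M[R]_n) : 'M[R]_r :=
  mxsub (fun i : 'I_r => widen_ord hr (lift ord0 i)) (widen_ord (ltnW hr)) M.

End Submatrices.

Lemma symmx_diagonalization (F : fieldType) n (G : 'M[F]_n) :
  (2%:R : F) != 0 -> G^T = G ->
  exists (s : nat) (P : 'M[F]_n) (d : 'I_n -> F),
   [/\ (s <= n)%N, P \in unitmx, (forall i : 'I_n, (i < s)%N -> d i != 0) &
    forall v : 'rV[F]_n, (v *m G *m v^T) 0 0 =
       \sum_(i < n | (i < s)%N) d i * ((v *m P) 0 i) ^+ 2].
Proof.
move=> nz2; elim: n G => [|n IHn] G symG.
  exists 0%N, 1%:M, (fun _ => 0); split=> //; first exact: unitmx1.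
  by move=> v; rewrite big_pred0 // mxE big_ord0.
have [/forallP G0|] := boolP [forall i, forall j, G i j == 0].
  exists 0%N, 1%:M, (fun _ => 0); split=> //; first exact: unitmx1.
  move=> v; rewrite big_pred0 //; have -> : G = 0.
    by apply/matrixP=> i j; rewrite mxE; apply/eqP; apply: (forallP (G0 i)).
  by rewrite mulmx0 mul0mx mxE.
move=> /forallPn[i /forallPn[j Gij]].
pose f (u v : 'rV[F]_n.+1) : F := (u *m G *m v^T) 0 0.
have fC u v : f u v = f v u.
  rewrite /f; have -> : v *m G *m u^T = (u *m G *m v^T)^T.
    by rewrite !trmx_mul trmxK symG mulmxA.
  by rewrite [RHS]mxE.
have fDl u v w : f (u + v) w = f u w + f v w by rewrite /f !mulmxDl mxE.
have fE k m : f (delta_mx 0 k) (delta_mx 0 m) = G k m.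
  by rewrite /f -rowE trmx_delta -colE !mxE.
have [v nzv] : exists v, f v v != 0.
  have [e1|] := eqVneq (G i i) 0; last by exists (delta_mx 0 i); rewrite fE.
  have [e2|] := eqVneq (G j j) 0; last by exists (delta_mx 0 j); rewrite fE.
  exists (delta_mx 0 i + delta_mx 0 j).
  rewrite fDl ![f _ (_ + _)]fC !fDl !fE e1 e2 add0r addr0 -(fE j) fC fE.
  by rewrite -mulr2n -mulr_natl mulf_neq0.
have [|U Uu eU] := @complete_unitmx F 1 n.+1 (delta_mx 0 0) (\matrix_k v).
  rewrite -rowE rowK mxrank_delta rank_rV; case: eqP => // v0.
  by move: nzv; rewrite /f v0 !mul0mx mxE eqxx.
rewrite -!rowE rowK in eU.
pose H : 'M_(1 + n) := U *m G *m U^T.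
have symH : H^T = H by rewrite /H !trmx_mul trmxK symG mulmxA.
pose c := H 0 0; pose g : 'cV_n := dlsubmx H; pose K : 'M_n := drsubmx H.
have nzc : c != 0.
  have -> // : c = f v v.
  rewrite /f eU rowE trmx_mul trmx_delta.
  have -> : delta_mx 0 0 *m U *m G *m (U^T *m delta_mx 0 0)
      = row 0 (H *m delta_mx 0 (0 : 'I_1)) by rewrite rowE /H !mulmxA.
  by rewrite -colE [RHS]mxE [RHS]mxE.
have eH : H = block_mx c%:M g^T g K.
  rewrite -[LHS]submxK -/g -/K; congr block_mx.
    rewrite [LHS]mx11_scalar [X in X%:M]mxE [X in X%:M]mxE; congr (_%:M).
    by rewrite /c; congr (fun_of_matrix H _ _); apply: val_inj.
  by rewrite /g trmx_dlsub symH.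
have [|s [P [d [sn Pu dP fP]]]] := IHn (K - c^-1 *: (g *m g^T)).
  rewrite linearB linearZ /= trmx_mul trmxK; congr (_ - _).
  by rewrite /K trmx_drsub symH.
pose W : 'M_(1 + n) := block_mx 1%:M 0 (c^-1 *: g) P.
exists s.+1, (invmx U *m W), (fun k => oapp d c (unlift ord0 k)); split=> //.
- rewrite unitmx_mul unitmx_inv Uu /= unitmxE.
  have -> : \det W = \det P by rewrite /W (@det_lblock _ 1 n) det1 mul1r.
  by rewrite -unitmxE.
- move=> k; case: unliftP => [m ->|_ _] //=; exact: dP.
move=> u; pose w : 'rV_(1 + n) := u *m invmx U.
have -> : u *m G *m u^T = w *m H *m w^T.
  rewrite /H /w trmx_mul !mulmxA mulmxKV // trmx_inv -!mulmxA.
  by rewrite mulKVmx ?unitmx_tr.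
rewrite (mulmxA u (invmx U) W) -/w.
suff: forall w : 'rV_(1 + n), (w *m H *m w^T) 0 0 =
   \sum_(i < 1 + n | (i < s.+1)%N)
      oapp d c (unlift (ord0 : 'I_n.+1) i) * (w *m W) 0 i ^+ 2;
  first by move=> hw; exact: (hw w).
move=> {}w; rewrite -[w](@hsubmxK _ 1 1 n); move: (lsubmx w) (rsubmx w) => t y.
have -> : row_mx t y *m W = row_mx (t + c^-1 *: (y *m g)) (y *m P).
  by rewrite /W mul_row_block mulmx1 mulmx0 add0r -scalemxAr.
rewrite eH tr_row_mx mul_row_block mul_row_col.
rewrite big_mkcond big_ord_recl /= unlift_none /=.
have -> : row_mx (t + c^-1 *: (y *m g)) (y *m P) 0 ord0
    = (t + c^-1 *: (y *m g)) 0 0.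
  rewrite -[RHS](row_mxEl _ (y *m P)); congr (fun_of_matrix _ _ _).
  exact: val_inj.
have := fP y; rewrite big_mkcond /= => eq2.
rewrite (eq_bigr (fun i : 'I_n =>
  if (i < s)%N then d i * (y *m P) 0 i ^+ 2 else 0)); last first.
  by move=> k _; rewrite liftK /= -(rshift1 k) row_mxEr.
rewrite -[X in _ = _ + X]eq2 mulmxBr -scalemxAr !mulmxA.
rewrite [y *m g]mx11_scalar; set b := (y *m g) 0 0.
have egy : g^T *m y^T = b%:M.
  by rewrite -trmx_mul [y *m g]mx11_scalar tr_scalar_mx.
rewrite [t]mx11_scalar; set a := t 0 0.
rewrite mulmxBl !mulmxDl -!scalemxAl -!mulmxA egy tr_scalar_mx !mulmxA.
rewrite -!scalar_mxM -scale_scalar_mx.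
move: (y *m K *m y^T) => Z; rewrite !mxE /= !mulr1n.
by field.
Qed.

Section WellDefinedness.
Variables (F : finFieldType) (E : fieldExtType F) (n : nat).
Local Notation q := #|F|.

Lemma expqD i (x y : E) : (x + y) ^+ (q ^ i) = x ^+ (q ^ i) + y ^+ (q ^ i).
Proof.
have [p pr_p ch] := finPcharP F.
have pq : p.-nat q.
  by rewrite -cardsT; apply: (abelem_pgroup (fin_ring_pchar_abelem ch)).
have chE : p \in [pchar E] by rewrite pchar_lalg.
apply: exprDn_pchar; rewrite (eq_pnat _ (pcharf_eq chE)).
by rewrite pnatX pq.
Qed.

Lemma expqA i (c : F) : (c%:A : E) ^+ (q ^ i) = c%:A.
Proof.
rewrite -[_%:A]/(in_alg E c) -rmorphXn; congr (_%:A).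
by elim: i => [|i IHi]; rewrite ?expr1 // expnSr exprM IHi expf_card.
Qed.

Lemma expqZ i (c : F) (x : E) : (c *: x) ^+ (q ^ i) = c *: x ^+ (q ^ i).
Proof. by rewrite -[c *: x]mulr_algl exprMn expqA mulr_algl. Qed.

Lemma qlinear_linear (l : {poly E}) : qlinear l -> linear (horner l).
Proof.
move=> [m [a ->]] c x y; rewrite !horner_sum scaler_sumr -big_split /=.
apply: eq_bigr => i _; rewrite !hornerZ !hornerXn expqD expqZ mulrDr.
by rewrite scalerAr.
Qed.

Lemma qadj_linear (l : {poly E}) : linear (horner (qadj n l)).
Proof.
move=> c x y; rewrite /qadj !hornerD !hornerZ !hornerX !horner_sum scalerDr.
rewrite addrACA scaler_sumr -big_split /=; congr (_ + _).
  by rewrite mulrDr scalerAr.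
apply: eq_bigr => i _; rewrite !horner_exp !hornerZ !hornerX mulrDr expqD.
by rewrite -scalerAr expqZ.
Qed.

Lemma qsym_linfun (l : {poly E}) :
  qlinear l -> linfun (horner (qsym n l)) =1 horner (qsym n l).
Proof.
move=> lP; have lin : linear (horner (qsym n l)).
  move=> c x y; rewrite /qsym.
  have lE : l.[c *: x + y] = c *: l.[x] + l.[y] by exact: qlinear_linear.
  have aE : (qadj n l).[c *: x + y] = c *: (qadj n l).[x] + (qadj n l).[y].
    exact: qadj_linear.
  move: (qadj n l) aE => a aE; rewrite !hornerZ !hornerD lE aE.
  by rewrite addrACA -scalerDr mulrDr scalerAr.
pose f := GRing.isLinear.Build _ _ _ _ _ lin.
pose g : {linear E -> E} := HB.pack (horner (qsym n l)) f.
exact: (lfunE g).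
Qed.

Lemma qtraceD x y : qtrace n (x + y) = qtrace n x + qtrace n y :> E.
Proof. by rewrite /qtrace -big_split; apply: eq_bigr => i _; rewrite expqD. Qed.
Lemma qtraceZ c x : qtrace n (c *: x) = c *: qtrace n x :> E.
Proof.
by rewrite /qtrace scaler_sumr; apply: eq_bigr => i _; rewrite expqZ.
Qed.

Lemma qtrace_in (x : E) : \dim {:E} = n -> exists c : F, qtrace n x = c%:A.
Proof.
move=> dimE; suff: qtrace n x \in 1%AS by case/vlineP=> c; exists c.
rewrite Fermat's_little_theorem /= dimv1 expn1.
have sumq m (g : 'I_m -> E) : (\sum_i g i) ^+ q = \sum_i g i ^+ q.
  elim: m g => [|m IHm] g.
    by rewrite !big_ord0 expr0n -[#|F|]prednK // (cardD1 0).
  by rewrite !big_ord_recl -{1}[q]expn1 expqD expn1 IHm.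
have xqn : x ^+ (q ^ n) = x.
  by apply/eqP; rewrite -dimE -(Fermat's_little_theorem {:E}%AS) memvf.
rewrite /qtrace sumq; move: xqn; case: (n) => [|k] xqn.
  by rewrite !big_ord0.
rewrite big_ord_recr [X in _ == X]big_ord_recl /= -exprM -expnSr xqn addrC.
rewrite expr1.
apply/eqP; congr (_ + _); apply: eq_bigr=> i _; by rewrite -exprM -expnSr.
Qed.

(* The hypothesis that eps is the invariant can always be met. *)
Lemma quadform_invariant_exists (l : {poly E}) :
  odd q -> \dim {:E} = n -> qlinear l ->
  exists eps, quadform_invariant n (trace_form n l) eps.
Proof.
move=> q_odd dimE lP.
have nz2 : (2%:R : F) != 0.
  apply/eqP => e2; have ch2 : 2%N \in [pchar F] by rewrite inE /= e2 eqxx.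
  have: (2%N : nat_pred).-nat q.
    by rewrite -cardsT; apply: (abelem_pgroup (fin_ring_pchar_abelem ch2)).
  move=> /p_natP[[|k] ek]; last by move: q_odd; rewrite ek oddX.
  by have := finNzRing_gt1 F; rewrite ek.
have lin := qlinear_linear lP.
have lD x y : l.[x + y] = l.[x] + l.[y] by have := lin 1 x y; rewrite !scale1r.
have l0 : l.[0] = 0 by apply: (addrI l.[0]); rewrite -lD !addr0.
have lZ c x : l.[c *: x] = c *: l.[x].
  by have := lin c x 0; rewrite l0 !addr0.
pose f x y : E := qtrace n (x * l.[y]).
have fDl x y z : f (x + y) z = f x z + f y z by rewrite /f mulrDl qtraceD.
have fDr x y z : f x (y + z) = f x y + f x z by rewrite /f lD mulrDr qtraceD.
have fZl c x y : f (c *: x) y = c *: f x y by rewrite /f -scalerAl qtraceZ.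
have fZr c x y : f x (c *: y) = c *: f x y by rewrite /f lZ -scalerAr qtraceZ.
have [h hE] : exists h : E -> E -> F, forall x y, f x y = (h x y)%:A.
  exists (fun x y => odflt 0 [pick c : F | f x y == c%:A]) => x y.
  case: pickP => [c /eqP //|no]; have [c fc] := qtrace_in (x * l.[y]) dimE.
  by have := no c; rewrite /f fc eqxx.
clear -nz2 fDl fDr fZl fZr hE dimE; subst n.
pose b0 := vbasis {:E}.
pose G : 'M[F]_(\dim {:E}) :=
  \matrix_(i, j) (2%:R^-1 * (h b0`_i b0`_j + h b0`_j b0`_i)).
have symG : G^T = G by apply/matrixP=> i j; rewrite !mxE addrC.
have [s [P [d [sn Pu dP dE]]]] := symmx_diagonalization nz2 symG.
pose b := [tuple \sum_k (invmx P) i k *: b0`_k | i < \dim {:E}].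
pose v x := \row_i coord b0 i x.
have f0l y : f 0 y = 0 by rewrite -[X in f X _](scale0r 0) fZl scale0r.
have f0r y : f y 0 = 0 by rewrite -[X in f _ X](scale0r 0) fZr scale0r.
have xE x : x = \sum_i v x 0 i *: b0`_i.
  by rewrite {1}(coord_vbasis (memvf x)); apply: eq_bigr => i _; rewrite mxE.
have xb x : x = \sum_i (v x *m P) 0 i *: b`_i.
  rewrite {1}[x]xE.
  transitivity (\sum_i \sum_k ((v x *m P) 0 i * invmx P i k) *: b0`_k).
    rewrite exchange_big /=; apply: eq_bigr => k _; rewrite -scaler_suml.
    by congr (_ *: _); rewrite -{1}[v x](mulmxK Pu) mxE.
  apply: eq_bigr => i _; rewrite -tnth_nth tnth_mktuple scaler_sumr.
  by apply: eq_bigr => k _; rewrite scalerA.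
have bb : basis_of {:E} b.
  rewrite basisEdim size_tuple leqnn andbT; apply/subvP => x _.
  rewrite [x]xb; apply: memv_suml => i _; apply: memvZ; apply: memv_span.
  by apply: mem_nth; rewrite size_tuple.
have cE x i : coord b i x = (v x *m P) 0 i.
  by rewrite {1}[x]xb coord_sum_free // (basis_free bb).
exists (quadchar (\prod_(i < \dim {:E} | (i < s)%N) d i)), s, b, d.
split=> // x.
under eq_bigr => i _ do rewrite cE.
rewrite -dE -[LHS]/(f x x) [in LHS](xE x).
have fsl m (g : 'I_m -> E) y : f (\sum_i g i) y = \sum_i f (g i) y.
  by apply: (big_morph (f^~ y)) => // *.
have fsr m (g : 'I_m -> E) y : f y (\sum_i g i) = \sum_i f y (g i).
  by apply: (big_morph (f y)) => // *.
have ->: (v x *m G *m (v x)^T) 0 0 =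
   \sum_i \sum_j v x 0 i * v x 0 j * h b0`_i b0`_j.
  transitivity (\sum_i \sum_j v x 0 i * v x 0 j * G i j).
    rewrite mxE exchange_big; apply: eq_bigr => j _ /=; rewrite !mxE mulr_suml.
    by apply: eq_bigr => i _; rewrite !mxE; ring.
  transitivity (2%:R^-1 * (\sum_i \sum_j v x 0 i * v x 0 j * h b0`_i b0`_j +
    \sum_i \sum_j v x 0 i * v x 0 j * h b0`_j b0`_i)).
    rewrite -big_split mulr_sumr; apply: eq_bigr => i _.
    rewrite -big_split mulr_sumr; apply: eq_bigr => j _ /=.
    by rewrite [G i j]mxE; ring.
  rewrite [X in _ + X]exchange_big /=.
  rewrite -[X in _ * (_ + X)]
    (_ : \sum_i \sum_j v x 0 i * v x 0 j * h b0`_i b0`_j = _).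
    by rewrite -mulr2n -[X in _ * X]mulr_natl mulKf.
  by apply: eq_bigr => i _; apply: eq_bigr => j _; rewrite [v x 0 i * _]mulrC.
rewrite fsl scaler_suml; apply: eq_bigr => i _.
rewrite fsr scaler_suml; apply: eq_bigr => j _.
by rewrite fZl fZr hE !scalerA.
Qed.
End WellDefinedness.

(* Main.v *)
Require Import Defs.
From HB Require Import structures.
From mathcomp Require Import all_boot all_order all_algebra all_fingroup.
From mathcomp Require Import all_solvable all_field.
From mathcomp Require Import ring.
(** In a basis b diagonalizing Tr(x l(x)), with dual basis be for the trace and
    diagonal coefficients d, polarization gives L(b j) = d j * be j.  Hence the
    rank is r and M_L = \sum_(k < r) d k * (be k ^ q^i * be k ^ q^j).  With
    Delta the product of the d k and delta the (nonzero) Moore determinant of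
    be, the two minors are Delta * delta^2 and Delta * delta^(q+1), which
    settles (1) and (2) by Euler's criterion.  For r = n and for (3) it remains
    to find t, with t / delta a power of a, such that t^q = (-1)^(n-1) t: then
    t^2 lies in F and is a square there exactly when n is odd.  The relation
    between delta^q and delta is the Laplace expansion of a singular matrix,
    namely the Moore matrix with one more row, bordered by a column supported on
    the first and last rows. *)

Set Implicit Arguments.
Unset Strict Implicit.
Unset Printing Implicit Defensive.

Import GRing.Theory.
Local Open Scope ring_scope.

Lemma odd_card_two_neq0 (F : finFieldType) : odd #|F| -> (2%:R : F) != 0.
Proof.
move=> q_odd; apply/eqP => e2.
have ch2 : 2%N \in [pchar F] by rewrite inE /= e2 eqxx.
have: (2%N : nat_pred).-nat #|F|.
  by rewrite -cardsT; apply: (abelem_pgroup (fin_ring_pchar_abelem ch2)).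
move=> /p_natP[[|k] ek]; last by move: q_odd; rewrite ek oddX.
by have := finNzRing_gt1 F; rewrite ek.
Qed.

(** * Euler's criterion and multiplicativity of the quadratic character *)

Section QuadraticCharacter.

Variable F : finFieldType.
Local Notation q := #|F|.
Hypothesis q_odd : odd q.

Lemma card_pred_half : (q.-1 = (q.-1)./2 * 2)%N.
Proof.
have q0 : (0 < q)%N by apply: leq_trans (finNzRing_gt1 F).
rewrite muln2; have := odd_double_half q.-1.
by move: q_odd; rewrite -{1}[q]prednK //= => /negbTE ->.
Qed.

Lemma expf_card_pred (c : F) : c != 0 -> c ^+ q.-1 = 1.
Proof.
move=> nzc; apply: (mulfI nzc); rewrite mulr1 -exprS prednK ?expf_card //.
exact: leq_trans (finNzRing_gt1 F).
Qed.

Lemma expf_card_half (c : F) : c != 0 ->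
  c ^+ (q.-1)./2 = 1 \/ c ^+ (q.-1)./2 = -1.
Proof.
move=> nzc; have /eqP : (c ^+ (q.-1)./2) ^+ 2 = 1.
  by rewrite -exprM -card_pred_half expf_card_pred.
by rewrite sqrf_eq1 => /orP[] /eqP; [left|right].
Qed.

(** Write [c = z ^+ i] with [z] a generator of F^*. If c^((q-1)/2) = 1, then q-1 divides i(q-1)/2,
    so [i] is even and [c] is the square of a power of [z]. *)
Lemma Euler_criterion (c : F) : c != 0 ->
  [exists y : F, c == y ^+ 2] = (c ^+ (q.-1)./2 == 1).
Proof.
move=> nzc; have q1 := finNzRing_gt1 F.
have qp0 : (0 < q.-1)%N by rewrite -subn1 subn_gt0.
apply/existsP/eqP => [[y /eqP cy]|c1].
  rewrite cy -exprM mulnC -card_pred_half expf_card_pred //.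
  by apply: contra nzc => /eqP y0; rewrite cy y0 expr0n.
have /hasP[z _ zP] : has q.-1.-primitive_root (enum [pred x : F | x != 0]).
  apply: has_prim_root; rewrite ?enum_uniq //.
    apply/allP => x; rewrite mem_enum inE => nzx.
    by rewrite unity_rootE expf_card_pred.
  rewrite -cardE; have := cardC1 (0 : F) => <-.
  by apply: eq_leq; apply: eq_card => x; rewrite !inE.
have [i ci] := prim_rootP zP (expf_card_pred nzc).
move/eqP: c1; rewrite ci -exprM -(prim_order_dvd zP).
rewrite {1}card_pred_half [(i * _)%N]mulnC dvdn_pmul2l; last first.
  by rewrite lt0n; apply: contraTneq qp0 => h0; rewrite card_pred_half h0.
by move=> /dvdnP[j ->]; exists (z ^+ j); rewrite exprM.
Qed.

Lemma quadchar_eq1 (c : F) : c != 0 ->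
  quadchar c = 1 <-> c ^+ (q.-1)./2 = 1.
Proof.
move=> nzc; rewrite /quadchar (negbTE nzc) Euler_criterion //.
by case: eqP.
Qed.

Lemma quadcharM (c d : F) : c != 0 -> d != 0 ->
  quadchar (c * d) = quadchar c * quadchar d.
Proof.
move=> nzc nzd; have nzcd : c * d != 0 by rewrite mulf_neq0.
rewrite /quadchar (negbTE nzc) (negbTE nzd) (negbTE nzcd) !Euler_criterion //.
have N1 : (-1 == 1 :> F) = false.
  by rewrite eq_sym -addr_eq0 -mulr2n (negbTE (odd_card_two_neq0 q_odd)).
rewrite exprMn; case: (expf_card_half nzc) (expf_card_half nzd) => -> [] ->.
- by rewrite mulr1 eqxx.
- by rewrite mul1r eqxx N1.
- by rewrite mulr1 eqxx N1.
- by rewrite mulrNN mulr1 eqxx N1.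
Qed.

Lemma quadchar_sqr (c : F) : c != 0 -> quadchar (c ^+ 2) = 1.
Proof.
move=> nzc; rewrite /quadchar expf_eq0 (negbTE nzc) /=.
by case: existsP => // [[]]; exists c.
Qed.

End QuadraticCharacter.

Lemma expn_card_inj (F : finFieldType) : injective (expn #|F|).
Proof. exact: (expnI (finNzRing_gt1 F)). Qed.

(** * Frobenius powers and Moore determinants *)

Section Frobenius.

Variables (F : finFieldType) (E : fieldExtType F).
Local Notation q := #|F|.

(** Named so that it can carry ring morphism structures: it then commutes with sums, products and
    determinants. *)
Definition qfrob (k : nat) (x : E) : E := x ^+ (q ^ k).

Fact qfrob_is_zmod_morphism k : zmod_morphism (qfrob k).
Proof.
move=> x y; rewrite /qfrob expqD; congr (_ + _).
by rewrite -scaleN1r expqZ scaleN1r.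
Qed.

Fact qfrob_is_monoid_morphism k : monoid_morphism (qfrob k).
Proof. by split=> [|x y]; rewrite /qfrob ?expr1n ?exprMn. Qed.

HB.instance Definition _ k :=
  GRing.isZmodMorphism.Build E E (qfrob k) (qfrob_is_zmod_morphism k).
HB.instance Definition _ k :=
  GRing.isMonoidMorphism.Build E E (qfrob k) (qfrob_is_monoid_morphism k).

Lemma expq_fixed (x : E) : x ^+ q = x -> exists c : F, x = c%:A.
Proof.
move=> /eqP xq; apply/vlineP; rewrite -[<[1]>%VS]/(1%AS : {vspace E}).
by rewrite Fermat's_little_theorem /= dimv1 expn1.
Qed.

(** Rectangular, because singularity arguments use r + 1 rows on only r elements. *)
Definition moore (k r : nat) (be : 'I_r -> E) : 'M[E]_(k, r) :=
  \matrix_(i, j) be j ^+ (q ^ i).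

Lemma qcoef_sum (k : nat) (a : nat -> E) (i : nat) :
  qcoef (\sum_(j < k) a j *: 'X^(q ^ j)) i = if (i < k)%N then a i else 0.
Proof.
rewrite /qcoef coef_sum; under eq_bigr => j _ do rewrite coefZ coefXn.
case: ifP => [lik|nik].
  rewrite (bigD1 (Ordinal lik)) //= eqxx mulr1 big1 ?addr0 // => j nj.
  by rewrite (inj_eq (@expn_card_inj F)) eq_sym -[i]/(val (Ordinal lik))
     (inj_eq val_inj) (negbTE nj) mulr0.
rewrite big1 // => j _; rewrite (inj_eq (@expn_card_inj F)).
by case: eqP => [ij|]; rewrite ?mulr0 //; rewrite ij ltn_ord in nik.
Qed.

(** Linear independence over F for families indexed by an ordinal, so that truncating a family is
    composition with [widen_ord]. *)
Definition qfree (k : nat) (be : 'I_k -> E) :=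
  forall c : 'I_k -> F, \sum_i c i *: be i = 0 -> forall i, c i = 0.

(* A row vector killing the Moore matrix is a nonzero q-polynomial of degree
   less than q ^ k vanishing at the q ^ k linear combinations of the be i. *)
Lemma moore_det_neq0 (k : nat) (be : 'I_k -> E) :
  qfree be -> \det (moore k be) != 0.
Proof.
move=> fr; apply/negP => /det0P[v nzv vM].
pose a i := if insub i is Some j then v 0 j else 0.
pose p := \sum_(j < k) a j *: 'X^(q ^ j).
have aE (j : 'I_k) : a j = v 0 j by rewrite /a valK.
have nzp : p != 0.
  apply: contraNneq nzv => p0; apply/eqP/rowP => j; rewrite mxE -aE.
  by have := @qcoef_sum k a j; rewrite -/p p0 /qcoef coef0 ltn_ord => <-.
have pbe j : p.[be j] = 0.
  move/rowP/(_ j): vM; rewrite !mxE => <-; rewrite horner_sum.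
  by apply: eq_bigr => i _; rewrite hornerZ hornerXn mxE aE.
have pql : qlinear p by exists k, a.
have lin := qlinear_linear pql.
have p0 : p.[0] = 0.
  rewrite horner_sum big1 // => i _; rewrite hornerZ hornerXn expr0n.
  by rewrite expn_eq0 -[q == 0%N]negbK -lt0n (ltnW (finNzRing_gt1 F)) mulr0.
pose comb (c : {ffun 'I_k -> F}) := \sum_i c i *: be i.
have comb_inj : injective comb.
  move=> c d /eqP; rewrite -subr_eq0 /comb -sumrB => /eqP e.
  apply/ffunP => i; apply/eqP; rewrite -subr_eq0; apply/eqP.
  apply: (fr (fun i => c i - d i)); rewrite -[RHS]e.
  by apply: eq_bigr => j _; rewrite scalerBl.
have := @max_poly_roots _ p (codom comb) nzp.
rewrite codomE map_inj_uniq // enum_uniq size_map -cardE card_ffun card_ord.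
move=> /(_ _ isT); case/(_ _)/idPn.
  apply/allP => _ /mapP[c _ ->]; apply/rootP.
  apply: (big_ind (fun x => p.[x] = 0)) => // [x y px py|i _].
    by have := lin 1 x y; rewrite !scale1r px py addr0.
  by have := lin (c i) (be i) 0; rewrite p0 !addr0 pbe scaler0.
rewrite -leqNgt; apply: leq_trans (size_sum _ _ _) _; apply/bigmax_leqP => i _.
apply: leq_trans (size_scale_leq _ _) _; rewrite size_polyXn.
by rewrite ltn_exp2l ?finNzRing_gt1 // ltn_ord.
Qed.

(** The shifted matrix is the entrywise Frobenius image of the Moore matrix. *)
Lemma det_moore_shift (r : nat) (be : 'I_r -> E) :
  \det (\matrix_(i < r, j < r) be j ^+ (q ^ i.+1)) = \det (moore r be) ^+ q.
Proof.
rewrite -[in RHS](expn1 q) -[RHS]/(qfrob 1 _) -det_map_mx; congr (\det _).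
by apply/matrixP => i j; rewrite !mxE /= /qfrob expn1 -exprM -expnSr.
Qed.

(* Laplace expansion, along its last column, of the singular matrix obtained by
   adjoining u to a Moore matrix with r + 1 rows. *)
Lemma det_moore_expansion (r : nat) (be : 'I_r -> E) (u : 'cV[E]_r.+1) :
  (0 < r)%N ->
  \det (\matrix_(i < r.+1, j < r.+1)
          if unlift ord_max j is Some k then be k ^+ (q ^ i) else u i 0) = 0 ->
  (forall i : 'I_r.+1, (0 < i < r)%N -> u i 0 = 0) ->
  u ord_max 0 * \det (moore r be)
    = (-1) ^+ r.+1 * (u ord0 0 * \det (moore r be) ^+ q).
Proof.
move=> r0 N0 u0; set N := (X in \det X) in N0.
have := expand_det_col N ord_max; rewrite N0.
rewrite big_ord_recr /= (bigD1 (Ordinal r0)) //= big1 ?addr0 => [|i ni].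
  rewrite /cofactor /=.
  have -> : row' ord_max (col' ord_max N) = moore r be.
    by apply/matrixP => i j; rewrite !mxE liftK lift_max.
  rewrite (_ : widen_ord _ _ = ord0); last exact: val_inj.
  (* Deleting the first row leaves exponents starting at q, hence the q-th power of the Moore
     determinant. *)
  have -> : row' ord0 (col' ord_max N)
     = \matrix_(i < r, j < r) be j ^+ (q ^ i.+1).
    by apply/matrixP => i j; rewrite !mxE liftK lift0.
  rewrite det_moore_shift !mxE unlift_none /= addnn.
  rewrite -[(-1) ^+ r.*2]signr_odd odd_double expr0 mul1r add0n.
  move=> /esym/eqP; rewrite addrC addr_eq0 => /eqP ->.
  by rewrite exprS; ring.
rewrite [N _ _]mxE unlift_none u0 ?mul0r //=.
by rewrite ltn_ord andbT lt0n; apply: contraNneq ni => i0; apply/eqP/val_inj.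
Qed.

End Frobenius.

(** * The trace bilinear form, its matrix and its diagonalization *)

Section TraceForm.

Variables (F : finFieldType) (E : fieldExtType F) (n : nat).
Local Notation q := #|F|.
Hypotheses (n_gt0 : (0 < n)%N) (dimE : \dim {:E} = n).

Lemma expq_dim (x : E) : x ^+ (q ^ n) = x.
Proof.
by apply/eqP; rewrite -dimE -(Fermat's_little_theorem {:E}%AS) memvf.
Qed.

(** Lets Frobenius exponents follow the cyclic indices of [qmatrix]. *)
Lemma expq_modn (x : E) i : x ^+ (q ^ (i %% n)) = x ^+ (q ^ i).
Proof.
rewrite {2}(divn_eq i n) expnD exprM; congr (_ ^+ _).
elim: (i %/ n)%N => [|k IHk]; first by rewrite mul0n expn0 expr1.
by rewrite mulSn expnD exprM expq_dim.
Qed.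

(** Frobenius commutes with the sum defining the trace and fixes its value, which lies in F. *)
Lemma qtrace_expq (x : E) k : qtrace n (x ^+ (q ^ k)) = qtrace n x.
Proof.
have [c xc] := qtrace_in x dimE.
transitivity (qfrob k (qtrace n x)).
  rewrite rmorph_sum; apply: eq_bigr => i _.
  by rewrite /= /qfrob -!exprM mulnC.
by rewrite xc /qfrob expqA.
Qed.

Lemma qtrace_sum (I : finType) (f : I -> E) :
  qtrace n (\sum_i f i) = \sum_i qtrace n (f i).
Proof.
apply: (big_morph (@qtrace F E n)); first exact: qtraceD.
by rewrite -[0 in LHS](scale0r 0) qtraceZ scale0r.
Qed.

(** The number [m] of terms given by [qlinear] may lie on either side of [n]; both sums are padded
    with zero terms up to [maxn m n]. *)
Lemma qlinear_expand (l : {poly E}) :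
  qlinear l -> ((size l).-1 < q ^ n)%N ->
  l = \sum_(i < n) qcoef l i *: 'X^(q ^ i).
Proof.
move=> [m [a lE]] szl.
have l0 i : (n <= i)%N -> qcoef l i = 0.
  move=> ni; apply: nth_default; apply: leq_trans (leqSpred _) _.
  by apply: leq_trans szl _; rewrite leq_exp2l ?finNzRing_gt1.
have lE' : l = \sum_(i < m) qcoef l i *: 'X^(q ^ i).
  by rewrite {1}lE; apply: eq_bigr => i _; rewrite lE qcoef_sum ltn_ord.
have l0m i : (m <= i)%N -> qcoef l i = 0.
  by move=> mi; rewrite lE qcoef_sum ltnNge mi.
have widen k k' : (k <= k')%N -> (forall i, (k <= i)%N -> qcoef l i = 0) ->
    \sum_(i < k) qcoef l i *: 'X^(q ^ i)
      = \sum_(i < k') qcoef l i *: 'X^(q ^ i).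
  move=> /subnKC <- l0k; rewrite big_split_ord /=.
  rewrite [X in _ = _ + X]big1 ?addr0 //.
  by move=> i _; rewrite l0k ?leq_addr // scale0r.
rewrite {1}lE' (widen _ _ (leq_maxl m n) l0m).
by rewrite -(widen _ _ (leq_maxr m n) l0).
Qed.

(** Substitute k = n - i in the definition. The reduction modulo n matters only at k = 0, where it
    returns the index 0. *)
Lemma qadjE (l : {poly E}) :
  qadj n l = \sum_(k < n) qcoef l ((n - k) %% n) ^+ (q ^ k) *: 'X^(q ^ k).
Proof.
rewrite /qadj -(prednK n_gt0) big_ord_recl subn0 modnn expn0 !expr1.
congr (_ + _); rewrite big_add1 /= big_mkord (reindex_inj rev_ord_inj) /=.
apply: eq_bigr => i _; rewrite exprZn /bump /= add1n.
have iltn := ltn_ord i.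
rewrite subnSK // subSn ?leq_subr // subKn ?(ltnW iltn) // subSS.
by rewrite modn_small // ltnS leq_subr.
Qed.

Lemma qsymE (l : {poly E}) : qlinear l -> ((size l).-1 < q ^ n)%N ->
  qsym n l = \sum_(k < n)
    (2%:R^-1 * (qcoef l k + qcoef l ((n - k) %% n) ^+ (q ^ k))) *: 'X^(q ^ k).
Proof.
move=> lql szl; rewrite /qsym {1}(qlinear_expand lql szl) qadjE -big_split.
by rewrite scaler_sumr; apply: eq_bigr => k _; rewrite /= -scalerDl scalerA.
Qed.

Lemma qcoef_qsym (l : {poly E}) k : qlinear l -> ((size l).-1 < q ^ n)%N ->
  (k < n)%N ->
  qcoef (qsym n l) k
    = 2%:R^-1 * (qcoef l k + qcoef l ((n - k) %% n) ^+ (q ^ k)).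
Proof.
move=> lql szl kn; rewrite qsymE // (qcoef_sum n (fun k =>
  2%:R^-1 * (qcoef l k + qcoef l ((n - k) %% n) ^+ (q ^ k)))).
by rewrite kn.
Qed.

Lemma qsym_expand (l : {poly E}) : qlinear l -> ((size l).-1 < q ^ n)%N ->
  qsym n l = \sum_(k < n) qcoef (qsym n l) k *: 'X^(q ^ k).
Proof.
move=> lql szl; rewrite {1}qsymE //; apply: eq_bigr => k _.
by rewrite qcoef_qsym.
Qed.

(** So [qadj] is the adjoint for the trace form. Raising x(a_k y)^(q^(n-k)) to the power q^k
    preserves its trace and turns the second factor into a_k y. *)
Lemma qtrace_qadj (l : {poly E}) x y :
  qlinear l -> ((size l).-1 < q ^ n)%N ->
  qtrace n (x * (qadj n l).[y]) = qtrace n (y * l.[x]).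
Proof.
move=> lql szl; rewrite {2}(qlinear_expand lql szl).
have -> : (qadj n l).[y] = \sum_(k < n) (qcoef l k * y) ^+ (q ^ (n - k)).
  rewrite /qadj hornerD horner_sum; case: n n_gt0 expq_dim => // k _ xq.
  rewrite big_add1 big_mkord big_ord_recl subn0 xq hornerZ hornerX /=.
  by congr (_ + _); apply: eq_bigr => i _; rewrite horner_exp hornerZ hornerX.
rewrite horner_sum !mulr_sumr !qtrace_sum; apply: eq_bigr => k _.
rewrite hornerZ hornerXn -(qtrace_expq _ k) exprMn -exprM -expnD.
by rewrite subnK ?(ltnW (ltn_ord k)) // expq_dim; congr qtrace; ring.
Qed.

(** Thus Tr(xL(y)) is the symmetric bilinear form polarizing Tr(xl(x)). *)
Lemma qtrace_qsym (l : {poly E}) x y :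
  qlinear l -> ((size l).-1 < q ^ n)%N ->
  qtrace n (x * (qsym n l).[y])
    = 2%:R^-1 * (qtrace n (x * l.[y]) + qtrace n (y * l.[x])).
Proof.
move=> lql szl; rewrite /qsym hornerZ hornerD.
have -> : 2%:R^-1 = (2%:R^-1 : F)%:A :> E.
  by rewrite -[_%:A]/(in_alg E _) fmorphV rmorph_nat.
rewrite mulr_algl -scalerAr qtraceZ mulrDr qtraceD qtrace_qadj //.
by rewrite mulr_algl.
Qed.

(** M_P is the Gram matrix of Tr(xP(y)) in the conjugate coordinates x^(q^s): in the s-th conjugate
    of xP(y), the coefficient of index k meets y^(q^(k+s)), so k = t - s modulo n. *)
Lemma qmatrix_bilinear (P : {poly E}) x y :
  P = \sum_(k < n) qcoef P k *: 'X^(q ^ k) ->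
  qtrace n (x * P.[y]) =
    \sum_(s < n) \sum_(t < n) x ^+ (q ^ s) * qmatrix n P s t * y ^+ (q ^ t).
Proof.
move=> PE; apply: eq_bigr => s _.
have hP (t : 'I_n) : ((t + (n - s)) %% n < n)%N by rewrite ltn_mod.
pose h (t : 'I_n) := Ordinal (hP t).
have h_inj : injective h.
  move=> t u /(congr1 val) /= /eqP; rewrite eqn_modDr !modn_small // => /eqP.
  exact: val_inj.
rewrite exprMn {1}PE horner_sum -[X in _ * X]/(qfrob s _) rmorph_sum /=.
rewrite mulr_sumr (reindex_inj h_inj) /=; apply: eq_bigr => t _.
rewrite !mxE /qfrob hornerZ hornerXn exprMn -exprM -expnD mulrA.
congr (_ * _); rewrite -expq_modn modnDml -addnA subnK ?(ltnW (ltn_ord s)) //.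
by rewrite modnDr expq_modn.
Qed.


Lemma qfree_widen (s : nat) (sn : (s <= n)%N) (be : 'I_n -> E) :
  qfree be -> qfree (be \o widen_ord sn).
Proof.
move=> fr c c0 i.
pose c' (j : 'I_n) := if insub (j : nat) is Some k then c k else 0 : F.
have c'E k : c' (widen_ord sn k) = c k.
  by rewrite /c' /= (_ : nat_of_ord k = val k) // valK.
rewrite -c'E; apply: fr; rewrite -[RHS]c0.
rewrite (bigID (fun j : 'I_n => (j < s)%N)) /= [X in _ + X]big1 ?addr0.
  rewrite (big_ord_narrow sn).
  by apply: eq_bigr => k _; rewrite c'E.
by move=> j js; rewrite /c' insubF ?scale0r //; apply: negbTE.
Qed.

(* be is the basis dual to b for the trace form. *)
Lemma qdual_basis (b : 'I_n -> E) : qfree b ->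
  exists2 be : 'I_n -> E, qfree be & (moore n b)^T *m moore n be = 1%:M.
Proof.
move=> fr; pose X := (moore n b)^T.
have Xu : X \in unitmx by rewrite unitmx_tr unitmxE unitfE moore_det_neq0.
(* The first row of X^(-1) gives \sum_k be_k b_k^(q^j) = [j = 0]. Raising the relation for j - i
   modulo n to the power q^i gives row i of [W *m X = 1]. *)
pose z := Ordinal n_gt0; pose be k := invmx X z k.
have WX : moore n be *m X = 1%:M.
  apply/matrixP => i j; rewrite !mxE.
  have tP : ((j + (n - i)) %% n < n)%N by rewrite ltn_mod.
  have := mulVmx Xu => /matrixP/(_ z (Ordinal tP)) /(congr1 (qfrob i)).
  rewrite !mxE rmorph_sum rmorph_nat /= => e.
  transitivity ((z == Ordinal tP)%:R : E).
    rewrite -e; apply: eq_bigr => k _; rewrite !mxE rmorphM /=; congr (_ * _).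
    rewrite /qfrob -exprM -expnD -[RHS]expq_modn modnDml -addnA.
    by rewrite subnK ?(ltnW (ltn_ord i)) // modnDr expq_modn.
  congr (nat_of_bool _)%:R; rewrite -!(inj_eq val_inj) /=.
  have := eqn_modDr (n - i) i j n.
  rewrite subnKC ?(ltnW (ltn_ord i)) // modnn => ->.
  by rewrite !modn_small.
have XW : X *m moore n be = 1%:M by apply: mulmx1C.
exists be => // c c0 k.
(* A relation over F among the [be k] holds for all their conjugates, so its coefficients form a
   column killed by the invertible Moore matrix. *)
have cW i : \sum_k (c k)%:A * be k ^+ (q ^ i) = 0.
  transitivity (qfrob i (\sum_k c k *: be k)); last by rewrite c0 rmorph0.
  rewrite rmorph_sum; apply: eq_bigr => j _ /=.
  by rewrite /qfrob expqZ mulr_algl.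
have: moore n be *m (\col_k (c k)%:A) = 0.
  apply/colP => i; rewrite !mxE -[RHS](cW i); apply: eq_bigr => j _.
  by rewrite !mxE mulrC.
move=> /(congr1 (mulmx X)); rewrite mulmxA XW mul1mx mulmx0 => /colP/(_ k).
rewrite !mxE => /eqP; rewrite scaler_eq0 oner_eq0 orbF; exact/eqP.
Qed.

(* On the basis b diagonalizing the trace form, L maps b j to d j *: be j. *)
Lemma qmatrix_factorization (l : {poly E}) (r : nat) (eps : int) :
  odd q -> qlinear l -> ((size l).-1 < q ^ n)%N ->
  \dim (qimage (qsym n l)) = r ->
  quadform_invariant n (trace_form n l) eps ->
  exists (d : 'I_r -> F) (be : 'I_r -> E),
    [/\ forall k, d k != 0, qfree be,
        forall i j, qmatrix n (qsym n l) i j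
          = \sum_k (d k)%:A * (be k ^+ (q ^ i) * be k ^+ (q ^ j))
      & eps = quadchar (\prod_k d k)].
Proof.
move=> q_odd lql szl dimL [s [b [d [sn bb dP QE ->]]]].
set L := qsym n l; set M := qmatrix n L.
have frb : qfree (tnth b).
  move=> c c0 i; have /freeP := basis_free bb; apply; rewrite -[RHS]c0.
  by apply: eq_bigr => j _; rewrite (tnth_nth 0).
have [be frbe XW] := qdual_basis frb.
set X := (moore n (tnth b))^T in XW; set W := moore n be in XW.
have WX : W *m X = 1%:M by apply: mulmx1C.
(* The values of [d] from index [s] on are arbitrary; they are replaced by 0. *)
pose dd (i : 'I_n) : E := if (i < s)%N then (d i)%:A else 0.
have nz2 : (2%:R : E) != 0.
  rewrite -(rmorph_nat (in_alg E)) fmorph_eq0; exact: odd_card_two_neq0.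
have lin := qlinear_linear lql.
have lD x y : l.[x + y] = l.[x] + l.[y] by have := lin 1 x y; rewrite !scale1r.
(* Polarization of the diagonal form, dividing by 2. *)
have BE x y : qtrace n (x * L.[y]) =
    (\sum_(i < n | (i < s)%N) d i * (coord b i x * coord b i y))%:A.
  have -> : qtrace n (x * L.[y]) = 2%:R^-1 *
      (trace_form n l (x + y) - trace_form n l x - trace_form n l y).
    rewrite qtrace_qsym //; congr (_ * _).
    by rewrite /trace_form lD mulrDl !mulrDr !qtraceD; ring.
  rewrite !QE -!scalerBl; apply: (mulfI nz2); rewrite mulVKf //.
  rewrite mulr_natl scalerMnl; congr (_%:A).
  rewrite -!sumrB -sumrMnl; apply: eq_bigr => i _.
  by rewrite linearD /=; ring.
have XMX : X *m M *m X^T = \matrix_(i, j) (dd i *+ (i == j)).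
  apply/matrixP => i j; rewrite !mxE.
  transitivity (qtrace n (tnth b i * L.[tnth b j])).
    rewrite (qmatrix_bilinear _ _ (qsym_expand lql szl)) -/L -/M.
    rewrite exchange_big /=.
    apply: eq_bigr => t _; rewrite !mxE mulr_suml; apply: eq_bigr => u _.
    by rewrite !mxE.
  rewrite BE; have crd k m : coord b k (tnth b m) = (k == m)%:R.
    by rewrite (tnth_nth 0) coord_free ?(basis_free bb) 1?eq_sym.
  rewrite /dd; case: (boolP (i < s)%N) => ins; last first.
    rewrite mul0rn big1 ?scale0r // => k ks; rewrite !crd.
    have -> : (k == i) = false by apply: contraNF ins => /eqP <-.
    by rewrite mul0r mulr0.
  rewrite (bigD1 i) //= big1 ?addr0 => [|k /andP[_ ki]]; last first.
    by rewrite !crd (negbTE ki) mul0r mulr0.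
  by rewrite !crd eqxx mul1r; case: eqP; rewrite ?mulr1 // mulr0 scale0r.
(* The Gram matrix on [b] is diagonal; multiplying by [W], the inverse of [X], moves one factor
   across. *)
have MX : M *m X^T = \matrix_(i, j) (dd j * be j ^+ (q ^ i)).
  rewrite -[M]mul1mx -WX -!mulmxA [X *m _]mulmxA XMX.
  apply/matrixP => i j; rewrite !mxE (bigD1 j) //= big1 ?addr0 => [|k kj].
    by rewrite !mxE eqxx mulr1n mulrC.
  by rewrite !mxE (negbTE kj) mulr0n mulr0.
have ME i j : M i j = \sum_k dd k * (be k ^+ (q ^ i) * be k ^+ (q ^ j)).
  rewrite -[M]mulmx1 -trmx1 -WX trmx_mul mulmxA MX mxE.
  by apply: eq_bigr => k _; rewrite !mxE mulrA.
(* The first row of M_L lists the coefficients of L, so the first row of [M *m X^T] lists the values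
   L(b_j). *)
have Lb j : L.[tnth b j] = dd j * be j.
  have /matrixP/(_ (Ordinal n_gt0) j) := MX; rewrite !mxE /= expr1 => <-.
  rewrite [L](qsym_expand lql szl) horner_sum -/L; apply: eq_bigr => k _.
  by rewrite !mxE hornerZ hornerXn /= subn0 modnDr modn_small // expr1.
(* The image of L is spanned by the [d j *: be j] with j < s, which are free; its dimension is
   therefore the rank of the form. *)
have es : s = r.
  rewrite -dimL /qimage -/L; pose f := linfun (horner L).
  have fE x : f x = L.[x] by rewrite /f /L qsym_linfun.
  pose bs := [tuple be (widen_ord sn i) | i < s].
  have frs : free bs.
    apply/freeP => c c0; apply: (@qfree_widen _ sn _ frbe c); rewrite -[RHS]c0.
    by apply: eq_bigr => i _; rewrite -tnth_nth tnth_mktuple.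
  rewrite -[s](size_tuple bs); move: frs; rewrite /free => /eqP <-.
  congr (\dim _); rewrite -(span_basis bb) limg_span.
  apply/eqP; rewrite eqEsubv; apply/andP; split; apply/span_subvP => x.
    case/tnthP => i ->; rewrite tnth_mktuple; set j := widen_ord sn i.
    have dj : d j != 0 by apply: dP; rewrite /= ltn_ord.
    have -> : be j = (d j)^-1 *: f (tnth b j).
      by rewrite fE Lb /dd /= ltn_ord mulr_algl scalerA mulVf ?scale1r.
    apply: memvZ; apply: memv_span; apply: map_f; exact: mem_tnth.
  case/mapP => y /tnthP[j ->] ->; rewrite fE Lb /dd.
  case: ifP => [js|_]; last by rewrite mul0r mem0v.
  rewrite mulr_algl; apply: memvZ; apply: memv_span.
  have -> : be j = tnth bs (Ordinal js).
    by rewrite tnth_mktuple; congr be; apply: val_inj.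
  exact: mem_tnth.
move: es => {dimL} es; subst s.
exists (d \o widen_ord sn), (be \o widen_ord sn); split.
- by move=> k /=; apply: dP; rewrite /= ltn_ord.
- exact: qfree_widen.
- move=> i j; rewrite ME (bigID (fun k : 'I_n => (k < r)%N)) /=.
  rewrite [X in _ + X]big1 ?addr0; last first.
    by move=> k /negbTE kr; rewrite /dd kr mul0r.
  rewrite (big_ord_narrow sn) /=; apply: eq_bigr => k _.
  by rewrite /dd /= ltn_ord.
by rewrite (big_ord_narrow sn).
Qed.

End TraceForm.

(** The matrix is A diag(d) B^T; with Moore matrices or their shifts it evaluates the minors of
    M_L. *)
Lemma det_sandwich_diag (R : comNzRingType) r (d : 'I_r -> R) (A B : 'M[R]_r) :
  \det (\matrix_(i, j) \sum_k d k * (A i k * B j k))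
    = \prod_k d k * (\det A * \det B).
Proof.
rewrite (_ : (\matrix_(i, j) _) = A *m diag_mx (\row_k d k) *m B^T).
  rewrite !det_mulmx det_diag det_tr; under eq_bigr do rewrite mxE.
  by rewrite mulrAC mulrC.
rewrite mul_mx_diag; apply/matrixP => i j; rewrite !mxE.
by apply: eq_bigr => k _; rewrite !mxE; ring.
Qed.

(** * Square classes from t^q = ±t, and singular bordered Moore matrices *)

Section Signs.

Variables (F : finFieldType) (E : fieldExtType F).
Local Notation q := #|F|.

(** As t^q = ±t, t^2 is fixed by Frobenius and lies in F. It is a square there exactly when t itself
    is in F, that is when [k] is even: a root y of t^2 in F would give t = y or t = -y. *)
Lemma quadchar_twist (t : E) (c : F) k :
  odd q -> t != 0 -> c != 0 -> t ^+ q = (-1) ^+ k * t ->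
  exists2 c' : F, c%:A * t ^+ 2 = c'%:A & quadchar c = (-1) ^+ k * quadchar c'.
Proof.
move=> q_odd nzt nzc tq.
have [v tv] : exists v : F, t ^+ 2 = v%:A.
  by apply: expq_fixed; rewrite -exprM mulnC exprM tq exprMn sqrr_sign mul1r.
have nzv : v != 0.
  by apply: contraNneq nzt => v0; rewrite -sqrf_eq0 tv v0 scale0r.
exists (c * v); first by rewrite tv mulr_algl scalerA.
suff vk : quadchar v = (-1) ^+ k.
  by rewrite quadcharM // vk mulrCA -expr2 sqrr_sign mulr1.
rewrite -signr_odd; move: tq; rewrite -signr_odd; case: (odd k) => /= tq.
  rewrite /quadchar (negbTE nzv); case: existsP => // [[y /eqP vy]]; exfalso.
  have /eqP : t ^+ 2 = (y%:A) ^+ 2.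
    by rewrite tv vy -[_%:A]/(in_alg E _) rmorphXn.
  rewrite eqf_sqr -[y%:A]/(in_alg E y) -rmorphN /= => ty.
  have [w tw] : exists w : F, t = w%:A by case/orP: ty => /eqP; eexists; eauto.
  move: tq; rewrite expr1 mulN1r {1}tw -{1}[q]expn1 expqA -tw => /eqP.
  rewrite -addr_eq0 -mulr2n -mulr_natl mulf_eq0 (negbTE nzt) orbF.
  rewrite -(rmorph_nat (in_alg E)) fmorph_eq0.
  by rewrite (negbTE (odd_card_two_neq0 q_odd)).
rewrite expr0 mul1r in tq; have [u tu] := expq_fixed tq.
have vu : v = u ^+ 2.
  by apply: (fmorph_inj (in_alg E)); rewrite rmorphXn /= -tv tu.
have nzu : u != 0 by apply: contraNneq nzv => u0; rewrite vu u0 expr0n.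
by rewrite vu quadchar_sqr.
Qed.

(** The last column is a combination of the others, so the matrix factors through [moore r.+1 be],
    of rank at most r. *)
Lemma det_moore_combination r (be : 'I_r -> E) (w : 'I_r -> E)
    (u : 'cV[E]_r.+1) :
  (forall i : 'I_r.+1, u i 0 = \sum_k w k * be k ^+ (q ^ i)) ->
  \det (\matrix_(i < r.+1, j < r.+1)
          if unlift ord_max j is Some k then be k ^+ (q ^ i) else u i 0) = 0.
Proof.
move=> uE; set N := (X in \det X).
have NE : N = moore r.+1 be *m \matrix_(k, j)
    if unlift ord_max j is Some k' then (k == k')%:R else w k.
  apply/matrixP => i j; rewrite !mxE; case: unliftP => [k ->|->]; last first.
    by rewrite uE; apply: eq_bigr => k _; rewrite !mxE unlift_none mulrC.
  rewrite (bigD1 k) //= big1 ?addr0 => [|k' k'k].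
    by rewrite !mxE liftK eqxx mulr1.
  by rewrite !mxE liftK (negbTE k'k) mulr0.
apply/eqP; apply: contraTT isT => nzN.
have := mxrankM_maxl (moore r.+1 be) (\matrix_(k, j)
    if unlift ord_max j is Some k' then (k == k')%:R else w k).
rewrite -NE mxrank_unit ?unitmxE ?unitfE // => /leq_trans/(_ (rank_leq_col _)).
by rewrite ltnn.
Qed.

(** Row n of the extended Moore matrix repeats row 0, since x^(q^n) = x. Bordering by 1 in these two
    rows and 0 elsewhere keeps them equal, so the expansion applies. *)
Lemma det_moore_cyclic n (be : 'I_n -> E) : (0 < n)%N -> \dim {:E} = n ->
  \det (moore n be) ^+ q = (-1) ^+ (n - 1) * \det (moore n be).
Proof.
move=> n0 dimE.
pose u : 'cV[E]_n.+1 := \col_i ((i == ord0) || (i == ord_max))%:R.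
have nz : (ord0 : 'I_n.+1) != ord_max.
  by rewrite -(inj_eq val_inj) /= neq_ltn n0.
have : u ord_max 0 * \det (moore n be)
    = (-1) ^+ n.+1 * (u ord0 0 * \det (moore n be) ^+ q).
  apply: det_moore_expansion => // [|i /andP[i0 iN]].
    apply: (determinant_alternate nz) => j; rewrite !mxE !eqxx orbT.
    by case: unliftP => // k _; rewrite expr1 (expq_dim dimE).
  by rewrite mxE -!(inj_eq val_inj) /= (gtn_eqF i0) (ltn_eqF iN).
rewrite !mxE !eqxx orbT !mul1r => e; rewrite {2}e mulrA -exprD.
by rewrite addnS -addSn subn1 prednK // addnn -signr_odd odd_double mul1r.
Qed.

End Signs.

(** * Minors of M_L as Moore determinants, and the resulting formulas for the invariant *)

Unset Implicit Arguments.

Theorem theorem2p2 (F : finFieldType) (E : fieldExtType F) (n r : nat)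
    (l : {poly E}) (eps : int)
    (q := #|F|) (L := qsym n l) (M := qmatrix n L)
    (q_odd : odd q)
    (n_gt1 : (1 < n)%N)
    (dimE : \dim {:E} = n)
    (l_neq0 : l != 0)
    (l_qlinear : qlinear l)
    (l_degree : ((size l).-1 < q ^ n)%N)
    (r_gt0 : (0 < r)%N)
    (r_le_n : (r <= n)%N)
    (dim_imL : \dim (qimage L) = r)
    (epsP : quadform_invariant n (trace_form n l) eps) :
  (r = n ->
     exists2 c : F, \det M = c%:A & eps = (-1) ^+ (n - 1) * quadchar c) /\
  (forall r_lt_n : (r < n)%N,
     let D := \det (leading_submx r_le_n M) in
     let D1 := \det (shifted_submx r_lt_n M) in
     [/\ D != 0,
         D ^+ (q + 1) = D1 ^+ 2 /\ (eps = 1 <-> D ^+ ((q + 1) %/ 2) = D1),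
         odd n -> (eps = 1 <-> exists y : E, D = y ^+ 2)
       & forall (m : nat) (a : E),
           (r + 2 * m)%N = n -> (size l).-1 = (q ^ m)%N -> lead_coef l = a ->
           exists2 c : F,
             a ^+ (2 * q ^ r * ((q ^ m - 1) %/ (q - 1))) * D = c%:A
             & eps = (-1) ^+ (n - 1) * quadchar c]).
Proof.
have n_gt0 := ltnW n_gt1.
have [d [be [dP frbe ME ->]]] := @qmatrix_factorization F E n n_gt0 dimE l r eps
  q_odd l_qlinear l_degree dim_imL epsP.
clear dim_imL.
have {}ME i j : M i j = \sum_k (d k)%:A * (be k ^+ (q ^ i) * be k ^+ (q ^ j)).
  exact: ME.
set De := \prod_k d k; set de := \det (moore r be).
have nzde : de != 0 by apply: moore_det_neq0.
have nzDe : De != 0 by apply/prodf_neq0 => k _; apply: dP.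
have DeA : \prod_k (d k)%:A = De%:A :> E.
  by rewrite -[RHS]/(in_alg E De) rmorph_prod.
split=> [rn | r_lt_n D D1].
  (* For r = n the element t is [de] itself. *)
  subst r; have [c cE qc] := quadchar_twist q_odd nzde nzDe
    (det_moore_cyclic be n_gt0 dimE).
  exists c => //; rewrite -cE -DeA expr2 -det_sandwich_diag; congr (\det _).
  by apply/matrixP => i j; rewrite ME !mxE; apply: eq_bigr => k _; rewrite !mxE.
have DE : D = De%:A * de ^+ 2.
  rewrite -DeA expr2 -det_sandwich_diag; congr (\det _).
  by apply/matrixP => i j; rewrite mxE ME mxE;
    apply: eq_bigr => k _; rewrite !mxE.
have D1E : D1 = De%:A * (de ^+ q * de).
  rewrite -DeA -det_moore_shift -det_sandwich_diag; congr (\det _).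
  by apply/matrixP => i j; rewrite mxE ME !mxE;
    apply: eq_bigr => k _; rewrite !mxE.
have DeA0 : De%:A != 0 :> E by rewrite scaler_eq0 oner_eq0 orbF.
have nzD : D != 0 by rewrite DE mulf_neq0 ?expf_neq0.
have nzD1 : D1 != 0 by rewrite D1E !mulf_neq0 ?expf_neq0.
pose h := (q.-1)./2.
have q2 : q = (h * 2).+1.
  by rewrite -card_pred_half // prednK // ltnW ?finNzRing_gt1.
have q12 : ((q + 1) %/ 2)%N = h.+1.
  by rewrite q2 addn1 -[_.+2]/(2 + h * 2)%N -mulSn mulnK.
(* With h = (q-1)/2, the factor [De ^+ h] is the sign ±1 that decides whether [De] is a square; both
   claims of (1) follow from this identity. *)
have DhE : D ^+ h.+1 = (De ^+ h)%:A * D1.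
  rewrite -[(_ ^+ h)%:A]/(in_alg E _) rmorphXn /= DE D1E q2.
  by rewrite exprMn -exprM -exprSr mulrA -exprSr mulnC.
split=> //.
- split.
    have -> : (q + 1 = h.+1 * 2)%N by rewrite q2 addn1 mulSn.
    rewrite exprM DhE exprMn -[X in X ^+ 2]/(in_alg E _) -!rmorphXn /= -exprM.
    by rewrite -card_pred_half // expf_card_pred // scale1r mul1r.
  rewrite q12 DhE (quadchar_eq1 q_odd nzDe) -/h; split=> [->|].
    by rewrite scale1r mul1r.
  rewrite -{2}[D1]mul1r => /(mulIf nzD1) /eqP.
  rewrite -[_%:A]/(in_alg E _) -[1 in X in X -> _](rmorph1 (in_alg E)).
  by move=> /eqP /fmorph_inj.
- move=> n_odd; rewrite /quadchar (negbTE nzDe).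
  split=> [|[y Dy]].
    case: existsP => // [[y /eqP Dy] _]; exists (y%:A * de).
    by rewrite DE Dy exprMn -[_%:A]/(in_alg E _) rmorphXn.
  case: existsP => // []; case.
  (* Since z^2 = De is in F, z^q = ±z. The sign -1 would give z^(q^n) = -z for odd n, whereas
     z^(q^n) = z; hence z is in F and [De] is a square there. *)
  pose z := y / de; have z2 : z ^+ 2 = De%:A.
    by rewrite /z expr_div_n -Dy DE mulfK ?expf_neq0.
  have zq : z ^+ q = z.
    have /eqP : (z ^+ q) ^+ 2 = z ^+ 2.
      by rewrite -exprM mulnC exprM z2 -[q]expn1 expqA.
    rewrite eqf_sqr => /orP[/eqP //|/eqP zN].
    have zqk k : z ^+ (q ^ k) = (-1) ^+ k * z.
      elim: k => [|k IHk]; first by rewrite expr1 mul1r.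
      rewrite expnSr exprM IHk exprMn zN -exprM mulnC exprM.
      by rewrite -[(-1) ^+ q]signr_odd q_odd expr1 exprS mulrN mulN1r mulNr.
    have := zqk n; rewrite (expq_dim dimE) -signr_odd n_odd mulN1r => zz.
    by rewrite zN -zz.
  have [w zw] := expq_fixed zq; exists w; apply/eqP.
  by apply: (fmorph_inj (in_alg E)); rewrite rmorphXn /= -z2 zw.
move=> m a rmn szl la.
have m_gt0 : (0 < m)%N.
  rewrite lt0n; apply: contraTneq (r_lt_n) => m0.
  by rewrite -rmn m0 muln0 addn0 ltnn.
have nE : n = (m + r + m)%N by rewrite -rmn mul2n -addnn addnCA addnA.
have lm : qcoef l m = a by rewrite -la /lead_coef szl.
have l0 i : (m < i)%N -> qcoef l i = 0.
  move=> mi; apply: nth_default; apply: leq_trans (leqSpred _) _.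
  by rewrite szl ltn_exp2l ?finNzRing_gt1.
have nza : a != 0 by rewrite -la lead_coef_eq0.
have mrn : (m + r < n)%N by rewrite nE -[X in (X < _)%N]addn0 ltn_add2l.
have nz2 : (2%:R : E) != 0.
  rewrite -(rmorph_nat (in_alg E)) fmorph_eq0; exact: odd_card_two_neq0.
have half_q i : (2%:R^-1 : E) ^+ (q ^ i) = 2%:R^-1.
  have -> : 2%:R^-1 = (2%:R^-1 : F)%:A :> E.
    by rewrite -[_%:A]/(in_alg E _) fmorphV rmorph_nat.
  exact: expqA.
have expq0 k : (0 : E) ^+ (q ^ k) = 0 by apply: rmorph0 (qfrob k).
(* Column m + r of M_L: the entry in row i comes from the coefficient of L of index m + r - i, whose
   opposite index modulo n = r + 2m is m + i. *)
have Mcol (i : 'I_r.+1) : M (widen_ord r_lt_n i) (Ordinal mrn) =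
    2%:R^-1 * (qcoef l (m + r - i) + qcoef l (m + i) ^+ (q ^ (m + r - i)))
                 ^+ (q ^ i).
  have ir : (i <= r)%N by rewrite -ltnS.
  have imr : (i <= m + r)%N by apply: leq_trans ir (leq_addl _ _).
  rewrite mxE /= addnBA ?(leq_trans ir) // -addnBAC // modnDr.
  have kn : (m + r - i < n)%N by apply: leq_ltn_trans (leq_subr _ _) mrn.
  rewrite modn_small // (qcoef_qsym n_gt0 l_qlinear) // exprMn half_q.
  have -> : (n - (m + r - i) = m + i)%N.
    by rewrite subnBA // {1}nE -addnA addKn.
  rewrite modn_small //; apply: leq_ltn_trans mrn; by rewrite leq_add2l.
(* For 0 < i < r both indices exceed m, so the entry vanishes as l has degree q^m. The end entries
   are a^(q^(m+r))/2 in row 0 and a^(q^r)/2 in row r. *)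
pose u : 'cV[E]_r.+1 := \col_i M (widen_ord r_lt_n i) (Ordinal mrn).
have : u ord_max 0 * de = (-1) ^+ r.+1 * (u ord0 0 * de ^+ q).
  apply: det_moore_expansion => //.
  apply: (@det_moore_combination _ _ _ _
    (fun k => (d k)%:A * be k ^+ (q ^ (m + r)))) => i.
  by rewrite mxE ME; apply: eq_bigr => k _; rewrite -mulrA [_ * be k ^+ _]mulrC.
  move=> i /andP[i0 ir]; rewrite mxE Mcol !l0 ?expq0 ?addr0 ?expq0 ?mulr0 //.
    by rewrite -addn1 leq_add2l.
  by rewrite -addnBA ?(ltnW ir) // -addn1 leq_add2l subn_gt0.
rewrite [u ord_max 0]mxE [u ord0 0]mxE !Mcol /= addnK addn0 subn0 lm.
rewrite l0; last by rewrite -addn1 leq_add2l.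
rewrite expr1 add0r expq0 addr0.
set e := ((q ^ m - 1) %/ (q - 1))%N => rel.
(* The exponent s = q^r e solves s(q-1) = q^r(q^m - 1), which is what turns [rel] into t^q = ±t. *)
pose t := a ^+ (q ^ r * e) * de.
have tq : t ^+ q = (-1) ^+ (n - 1) * t.
  have eq_e : (e * q + 1 = e + q ^ m)%N.
    have q1 : (0 < q - 1)%N by rewrite subn_gt0 finNzRing_gt1.
    have qm : (0 < q ^ m)%N by rewrite expn_gt0 (ltnW (finNzRing_gt1 F)).
    have ee : (e * (q - 1) = q ^ m - 1)%N.
      by rewrite divnK // !subn1 dvdn_pred_predX.
    by rewrite -[X in (e + X)%N](subnK qm) -ee addnA -mulnS subn1 prednK //
       (ltnW (finNzRing_gt1 F)).
  (* r and n have the same parity, because n = r + 2m. *)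
  have sgn : (-1) ^+ r.+1 = (-1) ^+ (n - 1) :> E.
    rewrite -signr_odd -[RHS]signr_odd oddB // -rmn oddD oddM /= addbF.
    by rewrite addbT.
  have {}rel : a ^+ (q ^ (m + r)) * de ^+ q
      = (-1) ^+ (n - 1) * (a ^+ (q ^ r) * de).
    apply: (mulfI (invr_neq0 nz2)).
    by rewrite [RHS]mulrCA [_^-1 * (_ * de)]mulrA rel sgn !mulrA -expr2
       sqrr_sign mul1r.
  apply: (mulfI (expf_neq0 (q ^ r) nza)).
  rewrite /t exprMn mulrA -exprM -exprD -{1}[(q ^ r)%N]muln1 -mulnA -mulnDr.
  rewrite addnC eq_e mulnDr exprD -expnD [(r + m)%N]addnC -mulrA rel.
  by ring.
have nzt : t != 0 by rewrite mulf_neq0 ?expf_neq0.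
have [c cE qc] := quadchar_twist q_odd nzt nzDe tq; exists c => //.
by rewrite -cE DE /t exprMn -exprM [(_ * e * 2)%N]mulnC mulnA mulrCA.
Qed.
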